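(* As formal power series in $x$ and $t$, with $G(x)=\sum_{n\ge 0} n^n\frac{x^{n+1}}{(n+1)!}$, \begin{align*} 1+ \sum_{n\ge 0} \sum_{k=0}^n |\mathcal{T}_{n,k}| \frac{t^{k+1}}{k!} \frac{x^{n+1}}{(n+1)!} &= \exp\big( t\,G(x)\big),\\ 1+ \sum_{n\ge 0} \sum_{k=0}^n |\mathcal{T}_{n,k}| (k+1) t^{k+1} \frac{x^{n+1}}{(n+1)!} &= \big(1-t\,G(x)\big)^{-1},\\ \sum_{n\ge 0} \sum_{k=0}^n |\mathcal{T}_{n,k}|\, t^{k+1} \frac{x^{n+1}}{(n+1)!} &= - \ln\big(1-t\,G(x)\big). \end{align*}
   Context: $\mathcal{T}_n$ is the set of rooted labeled trees on vertex set $[0,n]=\{0,\dots,n\}$. For $T\in\mathcal{T}_n$, the maximal decreasing subtree $\mathrm{MD}(T)$ is the subtree induced by the root and all vertices $v$ such that labels strictly decrease along the path from the root to $v$. $\mathcal{T}_{n,k}$ is the set of $T\in\mathcal{T}_n$ whose $\mathrm{MD}(T)$ has exactly $k+1$ vertices. Convention $0^0=1$. *)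

(* Defs.v *)
From HB Require Import structures.
From mathcomp Require Import all_boot all_order all_algebra.
From mathcomp Require Import boolp classical_sets.

Set Implicit Arguments.
Unset Strict Implicit.
Unset Printing Implicit Defensive.

Import GRing.Theory.
Local Open Scope ring_scope.

(** * Formal power series *)

Record fps (R : Type) := Fps { coefs : nat -> R }.

Notation "{ 'fps' R }" := (fps R) (at level 0, format "{ 'fps'  R }") : type_scope.

Lemma fpsP (R : Type) (f g : {fps R}) : (forall i, coefs f i = coefs g i) -> f = g.
Proof. by case: f g => [f] [g] /= /funext ->. Qed.

HB.instance Definition _ (R : Type) := gen_eqMixin {fps R}.
HB.instance Definition _ (R : Type) := gen_choiceMixin {fps R}.

Section ZmodStructure.
Variable R : zmodType.
Implicit Types f g h : {fps R}.

Definition fps_zero : {fps R} := Fps (fun=> 0).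
Definition fps_add f g := Fps (fun i => coefs f i + coefs g i).
Definition fps_opp f := Fps (fun i => - coefs f i).

Fact fps_addA : associative fps_add.
Proof. by move=> f g h; apply: fpsP => i /=; rewrite addrA. Qed.
Fact fps_addC : commutative fps_add.
Proof. by move=> f g; apply: fpsP => i /=; rewrite addrC. Qed.
Fact fps_add0 : left_id fps_zero fps_add.
Proof. by move=> f; apply: fpsP => i /=; rewrite add0r. Qed.
Fact fps_addN : left_inverse fps_zero fps_opp fps_add.
Proof. by move=> f; apply: fpsP => i /=; rewrite addNr. Qed.

HB.instance Definition _ :=
  GRing.isZmodule.Build {fps R} fps_addA fps_addC fps_add0 fps_addN.

Lemma coefs0 i : coefs (0 : {fps R}) i = 0.
Proof. by []. Qed.
Lemma coefsD f g i : coefs (f + g) i = coefs f i + coefs g i.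
Proof. by []. Qed.
Lemma coefsN f i : coefs (- f) i = - coefs f i.
Proof. by []. Qed.
Lemma coefsB f g i : coefs (f - g) i = coefs f i - coefs g i.
Proof. by []. Qed.
Lemma coefs_sum (I : Type) (r : seq I) (P : pred I) (F : I -> {fps R}) i :
  coefs (\sum_(j <- r | P j) F j) i = \sum_(j <- r | P j) coefs (F j) i.
Proof. by apply: (big_morph (fun f => coefs f i)). Qed.

(* The sum of a countable family is its X-adic limit: each coefficient of the
   partial sums is eventually constant. *)
Definition fps_sums (u : nat -> {fps R}) (S : {fps R}) : Prop :=
  forall i, exists N, forall n, (N <= n)%N ->
    coefs (\sum_(0 <= m < n) u m) i = coefs S i.

(* 0 when the family is not summable. *)
Definition fps_sum (u : nat -> {fps R}) : {fps R} := xget 0 [set S | fps_sums u S]%classic.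

Lemma fps_sums_unique u S : fps_sums u S -> fps_sum u = S.
Proof.
move=> uS; rewrite /fps_sum; case: xgetP => [T _ /= uT|/(_ S)//].
apply: fpsP => i; have [N HN] := uS i; have [M HM] := uT i.
by rewrite -(HN (maxn N M)) ?leq_maxl // -(HM (maxn N M)) ?leq_maxr.
Qed.

Lemma fps_sumsP u : (forall m i, (i < m)%N -> coefs (u m) i = 0) ->
  fps_sums u (Fps (fun i => \sum_(0 <= m < i.+1) coefs (u m) i)).
Proof.
move=> u0 i; exists i.+1 => n ltin /=; rewrite coefs_sum (big_cat_nat (leq0n _) ltin) //=.
rewrite [X in _ + X]big_nat_cond [X in _ + X]big1 ?addr0 // => m.
by rewrite andbT => /andP[/u0].
Qed.

Lemma coefs_fps_sum u i : (forall m i, (i < m)%N -> coefs (u m) i = 0) ->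
  coefs (fps_sum u) i = \sum_(0 <= m < i.+1) coefs (u m) i.
Proof. by move=> u0; rewrite (fps_sums_unique (fps_sumsP u0)). Qed.

End ZmodStructure.

Section RingStructure.
Variable R : comNzRingType.
Implicit Types f g h : {fps R}.

Definition fpsC (a : R) : {fps R} := Fps (fun i => if i is 0 then a else 0).
Definition fpsX : {fps R} := Fps (fun i => (i == 1%N)%:R).
Definition fps_mul f g : {fps R} :=
  Fps (fun i => \sum_(j < i.+1) coefs f j * coefs g (i - j)%N).

(* The ring laws are transferred from polynomials by truncation. *)
Let trunc n f : {poly R} := \poly_(i < n) coefs f i.

Let coef_trunc n f i : (trunc n f)`_i = if (i < n)%N then coefs f i else 0.
Proof. exact: coef_poly. Qed.

Let coef_trunc_mul f g n m i : (i < n)%N -> (i < m)%N ->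
  (trunc n f * trunc m g)`_i = coefs (fps_mul f g) i.
Proof.
move=> lein leim; rewrite coefM /=; apply: eq_bigr => j _.
have ltj : (j < n)%N by apply: leq_ltn_trans lein; rewrite -ltnS.
have ltij : (i - j < m)%N by apply: leq_ltn_trans (leq_subr _ _) leim.
by rewrite !coef_trunc ltj ltij.
Qed.

Let coef_mul_eq (p q p' q' : {poly R}) i :
  (forall j, (j <= i)%N -> p`_j = p'`_j) -> (forall j, (j <= i)%N -> q`_j = q'`_j) ->
  (p * q)`_i = (p' * q')`_i.
Proof.
move=> pp qq; rewrite !coefM; apply: eq_bigr => j _.
by rewrite pp ?qq ?leq_subr // -ltnS.
Qed.

Fact fps_mulC : commutative fps_mul.
Proof.
move=> f g; apply: fpsP => i.
by rewrite -!(@coef_trunc_mul _ _ i.+1 i.+1) // mulrC.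
Qed.

Fact fps_mulA : associative fps_mul.
Proof.
move=> f g h; apply: fpsP => i.
rewrite -!(@coef_trunc_mul _ _ i.+1 i.+1) //.
transitivity ((trunc i.+1 f * (trunc i.+1 g * trunc i.+1 h))`_i).
  apply: coef_mul_eq => // j leji.
  by rewrite coef_trunc ltnS leji coef_trunc_mul.
rewrite mulrA; apply: coef_mul_eq => // j leji.
by rewrite [RHS]coef_trunc ltnS leji coef_trunc_mul.
Qed.

Fact fps_mul1 : left_id (fpsC 1) fps_mul.
Proof.
move=> f; apply: fpsP => i /=; rewrite big_ord_recl /= mul1r subn0.
by rewrite big1 ?addr0 // => j _; rewrite mul0r.
Qed.

Fact fps_mulDl : left_distributive fps_mul (@fps_add R).
Proof.
move=> f g h; apply: fpsP => i /=; rewrite -big_split /=.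
by apply: eq_bigr => j _; rewrite mulrDl.
Qed.

Fact fps_one_neq0 : fpsC 1 != 0.
Proof. by apply/eqP => /(congr1 (fun f => coefs f 0))/eqP; rewrite oner_eq0. Qed.

HB.instance Definition _ := GRing.Zmodule_isComNzRing.Build {fps R}
  fps_mulA fps_mulC fps_mul1 fps_mulDl fps_one_neq0.

Lemma coefs1 i : coefs (1 : {fps R}) i = (i == 0%N)%:R.
Proof. by case: i. Qed.
Lemma coefsM f g i : coefs (f * g) i = \sum_(j < i.+1) coefs f j * coefs g (i - j)%N.
Proof. by []. Qed.

Lemma coefsXn_eq0 f m i : coefs f 0 = 0 -> (i < m)%N -> coefs (f ^+ m) i = 0.
Proof.
move=> f0; elim: m i => // m IHm i leim; rewrite exprS coefsM big1 // => -[[|j] /= ltj] _.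
  by rewrite f0 mul0r.
have /IHm-> : (i - j.+1 < m)%N; last by rewrite mulr0.
by apply: (@leq_trans i) leim; rewrite ltn_subrL; case: i ltj.
Qed.

End RingStructure.

Arguments fpsX {R}.

Section UnitRingStructure.
Variable R : comUnitRingType.
Implicit Types f g h : {fps R}.

Definition fps_unit : {pred {fps R}} := fun f => `[< exists g, g * f = 1 >].
Definition fps_inv f : {fps R} := xget f [set g | g * f = 1]%classic.

Fact fps_mulVx : {in fps_unit, left_inverse 1 fps_inv *%R}.
Proof. by move=> f /asboolP exg; exact: (xgetPex f exg). Qed.
Fact fps_unitPl f g : g * f = 1 -> fps_unit f.
Proof. by move=> gf; apply/asboolP; exists g. Qed.
Fact fps_inv_out : {in [predC fps_unit], fps_inv =1 id}.
Proof.
move=> f /asboolPn nf; rewrite /fps_inv; case: xgetP => // g _ gf.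
by case: nf; exists g.
Qed.

HB.instance Definition _ := GRing.ComNzRing_hasMulInverse.Build {fps R}
  fps_mulVx fps_unitPl fps_inv_out.

Let fps_geom h : coefs h 0 = 0 -> exists g, g * (1 - h) = 1.
Proof.
move=> h0; exists (Fps (fun i => \sum_(m < i.+1) coefs (h ^+ m) i)).
apply: fpsP => i; transitivity (coefs ((\sum_(m < i.+1) h ^+ m) * (1 - h)) i).
  rewrite !coefsM; apply: eq_bigr => -[j /= ltji] _; congr (_ * _).
  rewrite coefs_sum -!(big_mkord xpredT (fun m => coefs (h ^+ m) j)).
  rewrite (big_cat_nat (leq0n _) ltji) //= [X in _ + X]big_nat_cond [X in _ + X]big1 ?addr0 // => m.
  by rewrite andbT => /andP[ltjm _]; rewrite coefsXn_eq0.
rewrite mulrC -[X in (X - h)](expr1n _ i.+1) -opprB mulNr.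
by rewrite expr1n -subrX1 opprB coefsB coefsXn_eq0 ?subr0.
Qed.

Lemma fps_unitE f : (f \is a GRing.unit) = (coefs f 0 \is a GRing.unit).
Proof.
apply/idP/idP => [/mulVr/(congr1 (fun g => coefs g 0))|uf].
  rewrite coefsM big_ord1 subn0 coefs1 /= => fV.
  by apply/unitrPr; exists (coefs f^-1 0); rewrite mulrC.
have fE : fpsC (coefs f 0)^-1 * f = 1 - (1 - fpsC (coefs f 0)^-1 * f).
  by rewrite opprB addrC subrK.
have [|g] := @fps_geom (1 - fpsC (coefs f 0)^-1 * f).
  by rewrite coefsB coefsM big_ord1 subn0 coefs1 /= mulVr ?subrr.
by rewrite -fE mulrA => gf; apply/unitrPr; exists (g * fpsC (coefs f 0)^-1); rewrite mulrC.
Qed.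

Definition fps_exp f : {fps R} := fps_sum (fun m => f ^+ m / m`!%:R).
Definition fps_ln f : {fps R} :=
  fps_sum (fun m => (-1) ^+ m * (f - 1) ^+ m.+1 / m.+1%:R).

End UnitRingStructure.

(* Q[[x, t]] is represented as Q[[t]][[x]]. *)
Definition Qtx : comUnitRingType := {fps {fps rat}}.
Definition x : Qtx := fpsX.
Definition t : Qtx := fpsC fpsX.

Definition G : Qtx :=
  fps_sum (fun n : nat => (n ^ n)%:R * (x ^+ n.+1 / (n.+1)`!%:R) : Qtx).

(** * Rooted labeled trees *)

Section Trees.
Variable n : nat.
Local Notation V := 'I_n.+1.

(* A pair of an edge set and a root. *)
Definition rgraph := ({set {set V}} * V)%type.

Implicit Types (E : {set {set V}}) (T : rgraph).

Definition adj E : rel V := [rel u v | (u != v) && ([set u; v] \in E)].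
Definition simple_graph E : bool := [forall e in E, #|e| == 2].
Definition connected E : bool := [forall u, forall v, connect (adj E) u v].
Definition acyclic E : bool := `[< forall c : seq V, (2 < size c)%N -> ~ ucycle (adj E) c >].
Definition is_tree E : bool := [&& simple_graph E, connected E & acyclic E].

Definition trees : {set rgraph} := [set T | is_tree T.1].

(* The vertex set of the maximal decreasing subtree: [T.2 :: p] is the path from
   the root to [v]. *)
Definition MD T : {set V} :=
  [set v | `[< exists p : seq V, [/\ path (adj T.1) T.2 p, uniq (T.2 :: p),
                 last T.2 p = v & sorted [rel u w : V | (w < u)%N] (T.2 :: p)] >]].

Definition trees_MD (k : nat) : {set rgraph} := [set T in trees | #|MD T| == k.+1].

End Trees.

(* Main.v *)
From HB Require Import structures.
Require Import Defs.
From mathcomp Require Import all_boot all_order all_algebra.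
From mathcomp Require Import ring.
From mathcomp Require Import boolp.

Set Implicit Arguments.
Unset Strict Implicit.
Unset Printing Implicit Defensive.

Import GRing.Theory Num.Theory.
Local Open Scope ring_scope.

(* All three identities say that [(k + 1) |T_{n,k}|] is [(n + 1)!] times the coefficient
   of [x^(n+1)] in [G^(k+1)].

   Trees. Given [MD(T) = M], with [|M| = k + 1], the decreasing tree on [M] can be chosen
   in [k!] ways, since the parent of a non-maximal vertex of [M] is any larger vertex of
   [M]; the remaining vertices form a forest whose roots [v] hang from vertices of [M]
   smaller than [v]. Splitting a forest on [N] vertices by its set of roots, where the root [v]
   may be attached in [c_v] ways, shows that there are [P(N) - P'(N)] of them, with
   [P(y) = prod_v (y + c_v)]. Summed over [M], the polynomials [P] give a complete
   homogeneous symmetric polynomial in [y, ..., y + k + 1], that is, a finite difference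
   of [y^(n+1)].

   Series. [G = 1 - E_(-1)] with [E_a = sum_m a (a + m)^(m-1) x^m / m!], and Abel's identity
   says that [E_a E_b = E_(a+b)], so expanding [(1 - E_(-1))^(k+1)] gives the same
   finite difference. *)

(** * Abel's identity *)

Definition abel_poly (m : nat) : {poly rat} :=
  if m is m'.+1 then 'X * ('X + m%:R%:P) ^+ m' else 1.

(** Up to a shift by 1, differentiation acts on the Abel polynomials [X (X + m)^(m-1)] as on powers
    of [X], which makes them a sequence of binomial type. *)
Lemma deriv_abel_poly m :
  (abel_poly m.+1)^`() = (abel_poly m \Po ('X + 1)) *+ m.+1.
Proof.
rewrite /= derivM derivX mul1r deriv_exp derivD derivX derivC addr0 mul1r.
case: m => [|m] /=; first by rewrite !mulr0n mulr0 addr0 comp_polyC.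
rewrite comp_polyM rmorphXn /= !comp_polyD !comp_polyX comp_polyC.
have -> : 'X + 1 + m.+1%:R%:P = 'X + m.+2%:R%:P :> {poly rat}.
  by rewrite -addrA -polyC1 -polyCD nat1r.
rewrite -polyC1 [in LHS]exprS !polyCMn; set Y := _ ^+ m.
ring.
Qed.

Lemma eq_poly_deriv (p q : {poly rat}) : p^`() = q^`() -> p.[0] = q.[0] -> p = q.
Proof.
move=> dpq; rewrite !horner_coef0 => pq0; apply/polyP => -[//|i].
have := congr1 (fun r : {poly rat} => r`_i) dpq; rewrite /= !coef_deriv.
exact: pmulrnI.
Qed.

(** By induction on [m]: [deriv_abel_poly] reduces the derivatives of both sides to the previous
    case shifted by 1, and at 0 only the term [k = 0] survives, as [X] divides the other Abel
    polynomials. *)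
Lemma abel_identity (b : rat) m :
  \sum_(k < m.+1) (abel_poly k * (abel_poly (m - k)).[b]%:P) *+ 'C(m, k)
  = abel_poly m \Po ('X + b%:P).
Proof.
elim: m b => [|m IHm] b.
  by rewrite big_ord1 /= hornerC !mulr1 comp_polyC.
apply: eq_poly_deriv.
  rewrite deriv_comp deriv_abel_poly derivD derivX derivC addr0 mulr1.
  rewrite raddfMn /= -comp_polyA.
  have -> : ('X + 1) \Po ('X + b%:P) = ('X + b%:P) \Po ('X + 1) :> {poly rat}.
    by rewrite !comp_polyD !comp_polyX -polyC1 !comp_polyC addrAC.
  rewrite comp_polyA -IHm [in RHS]raddf_sum /= -sumrMnl [LHS]raddf_sum big_ord_recl /=.
  rewrite derivMn derivM !derivC mul0r mulr0 addr0 mul0rn add0r.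
  apply: eq_bigr => k _.
  rewrite derivMn derivM derivC mulr0 addr0 deriv_abel_poly /bump /= add1n subSS.
  rewrite !raddfMn /= !comp_polyM !comp_polyC mulrnAl -!mulrnA.
  by rewrite -mul_bin_diag mulnC.
rewrite horner_comp !hornerE big_ord_recl hornerD horner_sum big1 => [|k _].
  by rewrite bin0 mulr1n subn0 /= !hornerE.
by rewrite hornerMn /= !hornerE ?mul0rn.
Qed.

(** This is [exp(a T)] with [T = sum_(m > 0) m^(m-1) x^m / m!] the tree function, which explains the
    additivity in [a]. *)
Definition abel_series (a : rat) : {fps rat} :=
  Fps (fun m => (abel_poly m).[a] / m`!%:R).

Lemma abel_seriesD a b : abel_series (a + b) = abel_series a * abel_series b.
Proof.
apply: fpsP => m; rewrite coefsM /=.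
have /(congr1 (fun p => p.[a])) := abel_identity b m.
rewrite horner_comp !hornerE => <-; rewrite horner_sum mulr_suml.
apply: eq_bigr => k _; rewrite hornerMn !hornerE.
have km : (k <= m)%N by rewrite -ltnS.
rewrite -mulr_natr -(bin_fact km) !natrM.
have f0 i : i`!%:R != 0 :> rat by rewrite pnatr_eq0 -lt0n fact_gt0.
have b0 : 'C(m, k)%:R != 0 :> rat by rewrite pnatr_eq0 -lt0n bin_gt0.
by rewrite /=; field; rewrite !f0 b0.
Qed.

Lemma abel_series0 : abel_series 0 = 1.
Proof.
apply: fpsP => -[|m]; rewrite coefs1 /= ?hornerE ?mul0r //.
Qed.

Lemma abel_seriesX a i : abel_series a ^+ i = abel_series (a *+ i).
Proof.
elim: i => [|i IHi]; first by rewrite abel_series0.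
by rewrite exprS IHi mulrS abel_seriesD.
Qed.

(** [G] as a series in [x] alone. By the case [k = 0] of [card_trees_MD], it counts the trees in
    which no child of the root is smaller than the root. *)
Definition tree0_series : {fps rat} :=
  Fps (fun m => if m is n.+1 then (n ^ n)%:R / n.+1`!%:R else 0).

Lemma tree0_seriesE : tree0_series = 1 - abel_series (-1).
Proof.
apply: fpsP => -[|m]; rewrite coefsB coefs1 /= ?hornerC ?divr1 ?subrr //.
rewrite !hornerE -mulrN1z -natr1.
have -> : -1 + (m%:R + 1) = m%:R :> rat by ring.
by rewrite natrX; ring.
Qed.

Lemma coefs_tree0_seriesX j m :
  coefs (tree0_series ^+ j) m.+1 * m.+1`!%:R =
  \sum_(i < j.+1) ((-1) ^+ i * - i%:R * (m.+1%:R - i%:R) ^+ m) *+ 'C(j, i).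
Proof.
rewrite tree0_seriesE exprBn coefs_sum mulr_suml; apply: eq_bigr => i _.
have f0 : m.+1`!%:R != 0 :> rat by rewrite pnatr_eq0 -lt0n fact_gt0.
have coefsMn (f : {fps rat}) k : coefs (f *+ k) m.+1 = coefs f m.+1 *+ k.
  by elim: k => // k IHk; rewrite !mulrS coefsD IHk.
have coefs_sign (f : {fps rat}) k :
    coefs ((-1) ^+ k * f) m.+1 = (-1) ^+ k * coefs f m.+1.
  by rewrite -signr_odd -[in RHS]signr_odd; case: odd;
    rewrite ?expr1 ?mulN1r ?coefsN ?expr0 ?mul1r.
rewrite coefsMn expr1n mulr1 coefs_sign abel_seriesX /= !hornerE.
by rewrite mulrnAl /= divfK // mulNrn [_%:R - _]addrC.
Qed.

(** * Sums over subsets *)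

Section SubsetSum.
Variables (R : comNzRingType) (y : R) (N : nat).
Implicit Types W M : {set 'I_N}.

Definition below M (v : 'I_N) : {set 'I_N} := [set u in M | (u < v)%N].

(* The factors [y + c] that occur for [M] range over [y, ..., y + j]: this is the complete
   homogeneous symmetric polynomial of degree [#|W| - j] in these elements. *)
Definition subset_sum W j : R :=
  \sum_(M : {set 'I_N} | (M \subset W) && (#|M| == j))
     \prod_(v in W :\: M) (y + #|below M v|%:R).

(** The [j]-th forward difference, with step 1, of the power function [z^m] at [y]. *)
Definition diff_sum m j : R :=
  \sum_(i < j.+1) ((-1) ^+ i * (y + (j%:R - i%:R)) ^+ m) *+ 'C(j, i).

(** The factor [y + (j + 1 - i)] splits as [(y + j + 1) - i], and [i] is absorbed by
    [i C(j + 1, i) = (j + 1) C(j, i - 1)]. *)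
Lemma diff_sum_recr m j :
  diff_sum m.+1 j.+1 = diff_sum m j *+ j.+1 + (y + j.+1%:R) * diff_sum m j.+1.
Proof.
have -> : diff_sum m j *+ j.+1 =
    - \sum_(i < j.+2) ((-1) ^+ i * (y + (j.+1%:R - i%:R)) ^+ m) *+ 'C(j.+1, i) * i%:R.
  rewrite big_ord_recl mulr0 add0r -sumrMnl -sumrN; apply: eq_bigr => i _.
  have bin_diag : ('C(j, i) * j.+1 = 'C(j.+1, i.+1) * i.+1)%N.
    by rewrite mulnC (mul_bin_diag j.+1) mulnC.
  rewrite lift0 mulr_natr -!mulrnA -bin_diag exprS mulN1r mulNr mulNrn opprK.
  by rewrite -!natr1 opprD addrACA subrr addr0.
rewrite addrC mulr_sumr -sumrB; apply: eq_bigr => i _.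
rewrite exprS -!(mulr_natr (_ * _)).
have main (e a b c Y : R) :
    e * ((y + (a - b)) * Y) * c = (y + a) * (e * Y * c) - e * Y * c * b by ring.
exact: main.
Qed.

(** Removing the greatest element [w] of [W] gives the recurrence [diff_sum_recr]: if [w] is not in
    [M], its factor is [y + j], all of [M] being below it; if [w] is in [M], it is below no other
    vertex and affects no factor. *)
Lemma subset_sumE W j : subset_sum W j *+ j`! = diff_sum #|W| j.
Proof.
move: {2}#|W| (leqnn #|W|) => m; elim: m W j => [|m IHm] W j.
  rewrite leqn0 cards_eq0 => /eqP ->; rewrite cards0.
  transitivity (0 ^+ j *+ j`! : R).
    congr (_ *+ _); rewrite /subset_sum; case: j => [|j].
      rewrite (big_pred1 set0) => [|M]; last by rewrite subset0 cards_eq0 andbb.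
      by rewrite set0D big_set0 expr0.
    rewrite big_pred0 ?expr0n // => M; rewrite subset0.
    by apply/andP => -[/eqP ->]; rewrite cards0.
  transitivity ((1 - 1 : R) ^+ j).
    by rewrite subrr; case: j => // j; rewrite expr0n mul0rn.
  rewrite exprBn; apply: eq_bigr => i _.
  by rewrite !expr1n expr0 !mulr1.
case: (set_0Vmem W) => [->|[w0 w0W] leWm].
  by move=> _; apply: IHm; rewrite cards0.
have [w wW wmax] := @arg_maxnP _ w0 [in W] (@nat_of_ord N) w0W.
have cW : #|W| = #|W :\ w|.+1 by rewrite (cardsD1 w W) wW.
set W' := W :\ w in cW *; have leW' : (#|W'| <= m)%N by rewrite -ltnS -cW.
have wW' : w \notin W' by rewrite !inE eqxx.
have ltw v : v \in W' -> (v < w)%N.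
  by rewrite !inE => /andP[vw /wmax vlew]; rewrite ltn_neqAle vw.
have sumNw : \sum_(M : {set 'I_N} | [&& M \subset W, #|M| == j & w \notin M])
     \prod_(v in W :\: M) (y + #|below M v|%:R) = (y + j%:R) * subset_sum W' j.
  rewrite mulr_sumr; apply: eq_big => [M|M].
    by rewrite subsetD1 -andbA [(w \notin M) && _]andbC.
  move=> /and3P[MW /eqP <- wM].
  have -> : W :\: M = w |: (W' :\: M).
    by apply/setP => v; rewrite !inE; case: (v =P w) => [->|] //=; rewrite wM wW.
  rewrite big_setU1 ?inE ?eqxx ?andbF //=; congr ((y + _%:R) * _).
  congr #|pred_of_set _|; apply/setP => v; rewrite inE andb_idr // => vM; apply: ltw.
  by rewrite !inE (subsetP MW) // andbT; apply: contraNneq wM => <-.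
rewrite /subset_sum (bigID (fun M : {set 'I_N} => w \in M)) /=.
under [X in _ + X]eq_bigl => M do rewrite -andbA.
rewrite sumNw mulrnDl -mulrnAr IHm // cW.
case: j sumNw => [|j] _.
  rewrite big_pred0 => [|M]; last first.
    by apply/negbTE; rewrite cards_eq0; apply/negP => /andP[/andP[_ /eqP->]]; rewrite inE.
  rewrite mul0rn add0r addr0 /diff_sum !big_ord1 !subr0 !addr0 exprS.
  by rewrite !expr0 !mul1r.
rewrite diff_sum_recr; congr (_ + _).
rewrite factS mulnC mulrnA -IHm //; congr (_ *+ _ *+ _).
rewrite (reindex_onto (fun M : {set 'I_N} => w |: M) (fun M => M :\ w)) /=; last first.
  by move=> M /andP[_ wM]; rewrite setD1K.
apply: eq_big => [M|M].
  rewrite setU11 andbT.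
  have -> : ((w |: M) :\ w == M) = (w \notin M).
    apply/eqP/idP => [<-|wM]; first by rewrite !inE eqxx.
    by rewrite setU1K.
  case: (boolP (w \in M)) => wM; rewrite ?andbF ?andbT.
    by symmetry; apply/negbTE; apply: contraNN wW' => /andP[/subsetP/(_ w wM)].
  rewrite cardsU1 wM add1n eqSS; congr (_ && _).
  by rewrite subUset sub1set wW /W' subsetD1 wM andbT.
move=> /andP[_ /eqP Mw].
have wM : w \notin M by rewrite -Mw !inE eqxx.
have DE : W :\: (w |: M) = W' :\: M by rewrite setDDl.
rewrite DE; apply: eq_bigr => v; rewrite inE => /andP[_ vW'].
congr (y + _%:R); congr #|pred_of_set _|; apply/setP => u; rewrite !inE.
by case: eqP => // ->; rewrite (negPf wM) ltnNge ltnW ?ltw.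
Qed.
End SubsetSum.

(** * Forests *)

Section Forests.
Variable V : finType.
Implicit Types (f h : {ffun V -> V}) (S U A : {set V}) (C L : V -> {set V}).

(** For a parent function this is acyclicity outside [S]: on a finite type, every orbit meets [S]
    exactly when every cycle does. *)
Definition reaching S f := [forall v, [exists w in S, fconnect f v w]].

Lemma reachingP S f : reflect (forall v, exists k, iter k f v \in S) (reaching S f).
Proof.
apply: (iffP forallP) => fS v.
  have /exists_inP[w wS /iter_findex fw] := fS v.
  by exists (findex f v w); rewrite fw.
have [k kS] := fS v; apply/exists_inP; exists (iter k f v) => //.
exact: fconnect_iter.
Qed.

Lemma eq_reaching S f h : {in ~: S, f =1 h} -> reaching S f = reaching S h.
Proof.
have sub f1 f2 : {in ~: S, f1 =1 f2} -> reaching S f1 -> reaching S f2.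
  move=> f12 /reachingP f1S; apply/reachingP => v; have [k] := f1S v.
  elim: k v => [|k IHk] v; first by exists 0%N.
  have [vS|vS] := boolP (v \in S); first by exists 0%N.
  rewrite iterSr f12 ?inE // => /IHk[i iS]; by exists i.+1; rewrite iterSr.
move=> fh; apply/idP/idP; apply: sub => // v /fh //.
Qed.

Definition respects L f := [forall v, f v \in L v].

Lemma respectsP L f : reflect (forall v, f v \in L v) (respects L f).
Proof. exact: forallP. Qed.

Definition fixed_off S L v : {set V} := if v \in S then L v else [set v].

(** A function is the pair of its restrictions to [S] and to the complement, each completed by the
    identity; [P] constrains only the first, so the second is free. *)
Lemma card_family_split S L (P : pred {ffun V -> V}) :
    (forall f h, {in S, f =1 h} -> P f = P h) ->
  #|[set f | respects L f && P f]| =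
  ((\prod_(v in ~: S) #|L v|) * #|[set f | respects (fixed_off S L) f && P f]|)%N.
Proof.
move=> PS; pose out := [set f | respects (fixed_off (~: S) L) f].
have -> : (\prod_(v in ~: S) #|L v|)%N = #|out|.
  transitivity #|family (fixed_off (~: S) L)|; last by rewrite cardsE.
  rewrite card_family foldrE big_map big_enum big_mkcond /=.
  apply: eq_bigr => v _; rewrite /fixed_off.
  by case: ifP => _ //; rewrite cards1.
pose merge (p : {ffun V -> V} * {ffun V -> V}) : {ffun V -> V} :=
  [ffun v => if v \in S then p.2 v else p.1 v].
rewrite -cardsX -(card_in_imset (f := merge)).
  congr #|pred_of_set _|; apply/setP => f; rewrite inE.
  apply/andP/imsetP => [[/respectsP fL Pf]|[[g h]]].
    exists ([ffun v => if v \in S then v else f v], [ffun v => if v \in S then f v else v]).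
      rewrite !inE /=; apply/and3P; split.
      - apply/respectsP => v; rewrite ffunE /fixed_off inE.
        by case: (v \in S); rewrite /= ?inE ?fL.
      - apply/respectsP => v; rewrite ffunE /fixed_off.
        by case: (v \in S); rewrite /= ?inE ?fL.
      - by rewrite (PS _ f) // => v vS; rewrite ffunE vS.
    by apply/ffunP => v; rewrite !ffunE /=; case: (v \in S).
  rewrite !inE /= => /and3P[/respectsP gL /respectsP hL Ph] ->; split.
    apply/respectsP => v; rewrite ffunE /=.
    have := gL v; have := hL v; rewrite /fixed_off inE.
    by case: (v \in S).
  by rewrite (PS _ h) // => v vS; rewrite ffunE vS.
move=> [g h] [g' h']; rewrite !inE /= => /and3P[/respectsP gL /respectsP hL _].
move=> /and3P[/respectsP gL' /respectsP hL' _] /ffunP eq_merge.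
congr (_, _); apply/ffunP => v; move: (eq_merge v) (gL v) (gL' v) (hL v) (hL' v);
  rewrite !ffunE /fixed_off inE; case: (v \in S) => //= _.
  by rewrite !inE => /eqP-> /eqP->.
by move=> _ _; rewrite !inE => /eqP-> /eqP->.
Qed.

(* Forests on [U], encoded by parent functions fixing the complement of [U]: every tree
   hangs from a root [v] in [U] attached to a vertex of [C v]. *)
Definition forests U C : {set {ffun V -> V}} :=
  [set f | respects (fixed_off U (fun v => U :|: C v)) f && reaching (~: U) f].

(** Forests are classified by their set [A] of roots, the vertices of [U] whose parent lies outside
    [U]. Roots choose their parents independently; the rest is a forest on [U :\: A] hanging from
    [A]. *)
Lemma card_forests_rec U C : {in U, forall v, [disjoint C v & U]} ->
  #|forests U C| =
  (\sum_(A : {set V} | A \subset U)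
     (\prod_(v in A) #|C v|) * #|forests (U :\: A) (fun=> A)|)%N.
Proof.
move=> CU; pose roots f := [set v in U | f v \notin U].
rewrite -sum1_card (partition_big roots (fun A => A \subset U)) => [|f _]; last first.
  by apply/subsetP => v; rewrite inE => /andP[].
apply: eq_bigr => A AU; rewrite sum1dep_card.
pose L v := if v \in U :\: A then U else if v \in A then C v else [set v].
have inU v : v \in A -> v \in U by exact: (subsetP AU).
have LroE f : (respects L f) =
    (respects (fixed_off U (fun v => U :|: C v)) f) && (roots f == A).
  apply/respectsP/andP => [fL|[/respectsP fU /eqP rfA] v].
    split; last first.
      apply/eqP/setP => v; rewrite inE; have := fL v; rewrite /L inE.
      case: (boolP (v \in A)) => [vA|vA] /=; last by case: (v \in U) => // ->.
      rewrite inU //= => fvC; have := CU v (inU v vA); rewrite disjoint_subset.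
      by move=> /subsetP/(_ _ fvC); rewrite inE.
    apply/respectsP => v; have := fL v; rewrite /L /fixed_off inE.
    case: (boolP (v \in A)) => [vA|vA] /=; first by rewrite inU // inE => ->; rewrite orbT.
    by case: (v \in U) => //; rewrite inE => ->.
  have := fU v; rewrite /L /fixed_off -rfA !inE.
  by case: (v \in U) => //=; case: (boolP (f v \in U)) => //=; rewrite inE => /negPf ->.
have -> : [set f | (f \in forests U C) && (roots f == A)] =
          [set f | respects L f && reaching (~: (U :\: A)) f].
  apply/setP => f; rewrite inE [f \in forests _ _]inE inE LroE -!andbA; apply: andb_id2l => fU.
  rewrite andbC; apply: andb_id2l => /eqP rfA.
  (* From a vertex of [A] one more step leaves [U]. *)
  apply/reachingP/reachingP => fr v; have [k kU] := fr v.
    by exists k; move: kU; rewrite !inE => /negPf ->; rewrite andbF.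
  have [kA|kA] := boolP (iter k f v \in A).
    by exists k.+1; move: kA; rewrite -rfA !inE => /andP[].
  by exists k; move: kU; rewrite !inE kA.
rewrite (card_family_split (S := U :\: A)) => [|f h fh]; last first.
  by apply: eq_reaching => v; rewrite setCK; apply: fh.
congr (_ * _)%N.
  rewrite (bigID (mem A)) /= [X in (_ * X)%N]big1 ?muln1 => [|v /andP[]]; last first.
    by rewrite inE /L => /negPf-> /negPf->; rewrite cards1.
  apply: eq_big => [v|v /andP[vUA vA]]; last first.
    by move: vUA; rewrite inE /L => /negPf->; rewrite vA.
  by rewrite andb_idl // => vA; rewrite !inE vA.
congr #|pred_of_set _|; apply/setP => f; rewrite !inE; congr (_ && _).
have UE : U :\: A :|: A = U.
  by apply/setP => v; rewrite !inE; case: (boolP (v \in A)) => [/inU->|]; rewrite ?orbF.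
by apply/respectsP/respectsP => fL v; have := fL v;
  rewrite /fixed_off UE /L; case: (v \in U :\: A).
Qed.

Lemma card_forests0 U : U != set0 -> #|forests U (fun=> set0)| = 0%N.
Proof.
case/set0Pn => v vU; apply/eqP; rewrite cards_eq0; apply/eqP/setP => f.
rewrite !inE; apply/negbTE/negP => /andP[/respectsP fU /reachingP/(_ v)[k]].
rewrite inE => /negP; apply; elim: k => //= k IHk.
by have := fU (iter k f v); rewrite /fixed_off IHk setU0.
Qed.

Lemma card_forests_set0 C : #|forests set0 C| = 1%N.
Proof.
apply/eqP/cards1P; exists [ffun v => v]; apply/setP => f; rewrite !inE.
apply/andP/eqP => [[/respectsP f1 _]|->].
  by apply/ffunP => v; have := f1 v; rewrite /fixed_off inE ffunE inE => /eqP.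
split; first by apply/respectsP => v; rewrite ffunE /fixed_off inE inE.
by apply/reachingP => v; exists 0%N; rewrite !inE.
Qed.

Definition attach_poly U C : {poly rat} := \prod_(v in U) ('X + #|C v|%:R%:P).

Lemma attach_polyE U C :
  attach_poly U C =
  \sum_(A : {set V} | A \subset U) (\prod_(v in A) #|C v|)%N%:R *: 'X^#|U :\: A|.
Proof.
pose F v : {poly rat} := if v \in U then #|C v|%:R%:P else 0.
pose E v : {poly rat} := if v \in U then 'X else 1.
transitivity (\prod_v (F v + E v)).
  rewrite /attach_poly big_mkcond; apply: eq_bigr => v _; rewrite /F /E.
  by case: ifP => _; rewrite ?add0r // addrC.
rewrite bigA_distr (bigID (fun A : {set V} => A \subset U)) /= addrC big1 ?add0r.
  apply: eq_bigr => A AU; rewrite natr_prod -mul_polyC rmorph_prod.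
  rewrite -prodr_const (bigID (mem A)) /=; congr (_ * _).
    by apply: eq_bigr => v vA; rewrite vA /F (subsetP AU).
  rewrite big_mkcond [RHS]big_mkcond; apply: eq_bigr => v _.
  by rewrite inE /E; case: (v \in A).
move=> A /subsetPn[v vA vU]; rewrite (bigD1 v) //= vA /F (negPf vU).
by rewrite mul0r.
Qed.

(* The right-hand side is linear in the polynomial, so the recurrence reduces the formula
   to the case of a constant [C]; in this form it also covers an empty [U]. *)
Lemma card_forests U C : {in U, forall v, [disjoint C v & U]} ->
  #|forests U C|%:R = (attach_poly U C - (attach_poly U C)^`()).[#|U|%:R].
Proof.
move: {2}#|U| (leqnn #|U|) => m; elim: m U C => [|m IHm] U C.
  rewrite leqn0 cards_eq0 => /eqP-> _.
  by rewrite card_forests_set0 /attach_poly big_set0 derivC subr0 hornerC.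
move=> leU CU.
have forestsUA A : A \subset U -> #|forests (U :\: A) (fun=> A)|%:R =
    ('X^#|U :\: A| - ('X^#|U :\: A|)^`()).[#|U|%:R] :> rat.
  move=> AU; have [->|A0] := eqVneq A set0.
    rewrite setD0; have [->|U0] := eqVneq U set0.
      by rewrite card_forests_set0 cards0 expr0 derivC subr0 hornerC.
    (* Without roots there is no forest, and [N^N - N N^(N-1)] vanishes for [N = #|U|]. *)
    rewrite card_forests0 // derivXn hornerD hornerN hornerMn !hornerXn.
    rewrite -[_ ^+ _ *+ _]mulr_natr -exprSr prednK ?subrr //.
    by rewrite card_gt0.
  have cA : (#|U :\: A| + #|A| = #|U|)%N.
    by rewrite cardsD (setIidPr AU) subnK // subset_leq_card.
  rewrite IHm => [||v]; last first.
  - by rewrite inE disjoints_subset => /andP[vA _]; rewrite setCD subsetUr.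
  - by rewrite -ltnS (leq_trans _ leU) // -cA -addn1 leq_add2l card_gt0.
  (* For the constant attachment set [A] the polynomial is a power of [X + #|A|], whose value at
     [#|U :\: A|] is that of the power of [X] at [#|U|]. *)
  rewrite /attach_poly prodr_const deriv_exp derivD derivX derivC addr0 mul1r.
  rewrite derivXn !(hornerD, hornerN, hornerMn) !horner_exp hornerD hornerX hornerC.
  by rewrite -natrD cA hornerX.
rewrite card_forests_rec // attach_polyE natr_sum raddf_sum -sumrB horner_sum.
apply: eq_bigr => A AU; rewrite natrM forestsUA //.
by rewrite /= derivZ -scalerBr hornerZ.
Qed.
End Forests.

(** * Trees and parent functions *)

Section ParentFunctions.
Local Open Scope nat_scope.
Variable n : nat.
Local Notation V := 'I_n.+1.
Implicit Types (f : {ffun V -> V}) (r u v w : V) (E : {set {set V}}) (M : {set V}).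

Definition parent_tree f r := (f r == r) && reaching [set r] f.

Definition parent_edges f r := [set [set v; f v] | v in [set~ r]].

Section ParentTree.
Variables (f : {ffun V -> V}) (r : V).
Hypothesis fr : parent_tree f r.

Let froot : f r = r. Proof. by have /andP[/eqP] := fr. Qed.

Let fconn v : fconnect f v r.
Proof.
have /andP[_ /forallP/(_ v)/exists_inP[w]] := fr.
by rewrite inE => /eqP->.
Qed.

Let depth v := findex f v r.

Let depthS v : v != r -> depth v = (depth (f v)).+1.
Proof. by rewrite eq_sym => vr; apply: (fconnect_findex (fconn v) vr). Qed.

Let depthF v : f v != v -> depth v = (depth (f v)).+1.
Proof. by move=> fv; apply: depthS; apply: contraNneq fv => ->; rewrite froot. Qed.

Lemma parent_neq v : v != r -> f v != v.
Proof. by move=> vr; apply/eqP => fv; have := depthS vr; rewrite fv => /n_Sn. Qed.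

Lemma parent_neq2 v : v != r -> f (f v) != v.
Proof.
move=> vr; have [->|fvr] := eqVneq (f v) r; first by rewrite froot eq_sym.
by apply/eqP => ffv; have := depthS vr; rewrite (depthS fvr) ffv; elim: depth => // k IHk [].
Qed.

Lemma parent_ind (P : V -> Prop) :
  P r -> (forall v, v != r -> P (f v) -> P v) -> forall v, P v.
Proof.
move=> Pr Pf v; have [k] := ubnP (depth v); elim: k v => // k IHk v.
have [-> //|vr] := eqVneq v r.
by rewrite ltnS depthS // => /IHk; apply: Pf.
Qed.

Lemma adj_parent_edges u w :
  adj (parent_edges f r) u w = (u != w) && ((f u == w) || (f w == u)).
Proof.
rewrite /adj /=; apply: andb_id2l => uw; apply/imsetP/orP => [[v vr uwE]|].
  have /setP uwv := uwE.
  have := uwv u; have := uwv w; rewrite !inE !eqxx orbT /=.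
  move=> /esym/orP[]/eqP wv /esym/orP[]/eqP uv; subst; rewrite ?eqxx ?orbT in uw *;
   by [|left|right].
case=> /eqP fu.
  by exists u; rewrite ?inE ?fu //; apply: contraNneq uw => ur; rewrite -fu ur froot.
exists w; last by rewrite fu setUC.
by rewrite !inE; apply: contraNneq uw => wr; rewrite -fu wr froot.
Qed.

Lemma parent_edges_connected : connected (parent_edges f r).
Proof.
have symE : connect_sym (adj (parent_edges f r)).
  by apply: sym_connect_sym => u v; rewrite !adj_parent_edges eq_sym orbC.
have conn_r v : connect (adj (parent_edges f r)) v r.
  elim/parent_ind: v => [|v vr]; first exact: connect0.
  apply: connect_trans; apply: connect1.
  by rewrite adj_parent_edges eqxx andbT eq_sym parent_neq.
by apply/forallP => u; apply/forallP => v; apply: connect_trans (conn_r u) _; rewrite symE.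
Qed.

(* The two neighbours, on a cycle, of a vertex of maximal depth would both be its parent. *)
Lemma parent_edges_acyclic : acyclic (parent_edges f r).
Proof.
apply/asboolP => c sc /andP[cyc uc].
have [x0 x0c] : exists x, x \in c by case: c sc {cyc uc} => // x c; exists x; rewrite mem_head.
have [x xc xmax] := @arg_maxnP _ x0 [in c] depth x0c.
have [i q cE] := rot_to xc.
rewrite -(rot_cycle i) cE in cyc; rewrite -(rot_uniq i) cE in uc.
rewrite -(size_rot i) cE in sc.
have par y : y \in x :: q -> adj (parent_edges f r) x y -> f x = y.
  move=> yq; rewrite adj_parent_edges => /andP[xy /orP[/eqP //|/eqP fy]].
  have := xmax y; rewrite -(mem_rot i) cE => /(_ yq).
  by rewrite /= leqNgt (depthF (v := y)) fy ?ltnSn.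
case: q cE cyc uc sc par => // y q _ cyc uc sc par.
move: cyc; rewrite /= rcons_path => /andP[xy /andP[_ yx]].
have fy : f x = y by apply: par; rewrite // !inE eqxx orbT.
have fz : f x = last y q.
  apply: par; first by rewrite inE mem_last orbT.
  by move: yx; rewrite !adj_parent_edges eq_sym orbC.
case: q sc uc fz {par xy yx} => // z q _ /= /and3P[_ + _] fz.
by rewrite -fy fz mem_last.
Qed.

Lemma parent_edges_tree : is_tree (parent_edges f r).
Proof.
apply/and3P; split; last exact: parent_edges_acyclic.
  apply/forall_inP => e /imsetP[v]; rewrite inE in_set1 => vr ->.
  by rewrite cards2 [v == _]eq_sym parent_neq.
exact: parent_edges_connected.
Qed.

(** A simple path from the root never climbs: it entered its current vertex from the parent, so a
    step to the parent would repeat a vertex. *)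
Lemma parent_path p : path (adj (parent_edges f r)) r p -> uniq (r :: p) ->
  path [rel u v | f v == u] r p.
Proof.
elim/last_ind: p => // p v IHp; rewrite !rcons_path -rcons_cons rcons_uniq.
move=> /andP[pE adjv] /andP[vp up]; rewrite IHp //=.
move: adjv; rewrite adj_parent_edges => /andP[_ /orP[/eqP fp|//]].
case/lastP: p => [|p w] in IHp pE vp up fp *.
  by move: vp; rewrite -fp /= froot inE eqxx.
have := IHp pE up; rewrite rcons_path last_rcons in fp *.
by rewrite /= fp => /andP[_ /eqP vE]; move: vp; rewrite vE -rcons_cons mem_rcons inE mem_last orbT.
Qed.

Lemma mem_MD_root : r \in MD (parent_edges f r, r).
Proof. by rewrite inE; apply/asboolP; exists [::]. Qed.

(** By [parent_path] the simple path to [v] ends with the edge from [f v], so membership is a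
    recursion along parents. *)
Lemma mem_MD_parent v : v != r ->
  (v \in MD (parent_edges f r, r)) = (v < f v) && (f v \in MD (parent_edges f r, r)).
Proof.
move=> vr; rewrite !inE; apply/asboolP/andP => [[p []]|[vf /asboolP[p []]]] /=.
  case/lastP: p => [_ _ /= rv _|p w]; first by rewrite rv eqxx in vr.
  rewrite last_rcons => pE up wv; subst w; rewrite !rcons_path => /andP[sp vp].
  have := parent_path pE up; rewrite rcons_path => /andP[_ /eqP fv].
  rewrite fv; split=> //; apply/asboolP; exists p; split=> //.
    by move: pE; rewrite rcons_path => /andP[].
  by have : uniq (rcons (r :: p) v) := up; rewrite rcons_uniq => /andP[].
move=> pE up pv sp; exists (rcons p v).
have sv : path [rel u w : V | w < u] r (rcons p v) by rewrite rcons_path sp /= pv.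
split=> //; last by rewrite last_rcons.
- rewrite rcons_path pE pv adj_parent_edges eqxx orbT andbT /=.
  exact: parent_neq.
- apply: (@sorted_uniq _ [rel u w : V | w < u] _ _ (r :: rcons p v)) sv => [u w x|u] /=;
    last exact: ltnn.
  by move=> uw /ltn_trans; apply.
Qed.

End ParentTree.

(** Induction from the root: if [g v] differed from [f v], the edge between [v] and [f v] would come
    from [g (f v) = v], whence [f (f v) = v], against [parent_neq2]. *)
Lemma parent_edges_inj f g r : parent_tree f r -> parent_tree g r ->
  parent_edges f r = parent_edges g r -> f = g.
Proof.
move=> fr gr fg; apply/ffunP.
have [/andP[/eqP froot _] /andP[/eqP groot _]] := (fr, gr).
apply: (parent_ind fr); first by rewrite froot groot.
move=> v vr IHv; have := adj_parent_edges gr v (f v).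
rewrite -fg adj_parent_edges // eqxx [v == f v]eq_sym (parent_neq fr vr) /=.
case/esym/orP => /eqP // gfv.
by have := parent_neq2 fr vr; rewrite IHv gfv eqxx.
Qed.

(** The parent of [v] is a neighbour of [v] closer to [r]. The parent edges form a spanning tree
    inside [E], and any further edge of [E] would close a cycle. *)
Lemma tree_parent E r : is_tree E -> exists2 f, parent_tree f r & parent_edges f r = E.
Proof.
move=> /and3P[/forall_inP simpleE /forallP connE /asboolP acycE].
have has_dist v : exists k, [exists p : k.-tuple V, path (adj E) r p && (last r p == v)].
  have /forallP/(_ v)/connectP[p pE ->] := connE r.
  by exists (size p); apply/existsP; exists (in_tuple p); rewrite pE /=.
pose dist v := ex_minn (has_dist v).
have distP p : path (adj E) r p -> dist (last r p) <= size p.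
  move=> pE; rewrite /dist; case: ex_minnP => k _; apply.
  by apply/existsP; exists (in_tuple p); rewrite pE /=.
have symE u v : adj E u v = adj E v u by rewrite /adj /= eq_sym setUC.
have closer v : v != r -> exists u, adj E v u && (dist u < dist v).
  move=> vr; rewrite {2}/dist; case: ex_minnP => k /existsP[p /andP[pE /eqP pv]] _.
  case/lastP: {p}(tval p) (size_tuple p) pE pv => [_ _ /= rv|p u].
    by rewrite rv eqxx in vr.
  rewrite size_rcons rcons_path last_rcons => <- /andP[pE adjE] <-.
  by exists (last r p); rewrite symE adjE ltnS distP.
(* By [closer], [pick] succeeds away from the root, so the default [v] is never taken. *)
pose f : {ffun V -> V} :=
  [ffun v => if v == r then r else odflt v [pick u | adj E v u && (dist u < dist v)]].
have froot : f r = r by rewrite ffunE eqxx.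
have fP v : v != r -> adj E v (f v) && (dist (f v) < dist v).
  move=> vr; rewrite ffunE (negPf vr); case: pickP => //= none.
  by have [u] := closer v vr; rewrite none.
have fr : parent_tree f r.
  rewrite /parent_tree froot eqxx; apply/reachingP => v.
  have [k] := ubnP (dist v); elim: k v => // k IHk v.
  have [->|vr] := eqVneq v r; first by exists 0; rewrite inE.
  have /andP[_ dv] := fP v vr; rewrite ltnS => /(leq_trans dv)/IHk[i].
  by exists i.+1; rewrite iterSr.
have subE e : e \in parent_edges f r -> e \in E.
  by case/imsetP => v; rewrite !inE => vr ->; have /andP[/andP[]] := fP v vr.
exists f => //; apply/setP => e; apply/idP/idP; first exact: subE.
move=> eE; have /cards2P[u [w [uw eE']]] := simpleE e eE; subst e.
apply/negPn/negP => efE.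
have /forallP/(_ u)/forallP/(_ w)/connectP[p0 p0E wE] := parent_edges_connected fr.
move: wE; case/shortenP: p0E => p pE up _ wE.
(* The path [p] of parent edges has at least two steps, since [[set u; w]] is not a parent edge. *)
apply: (acycE (u :: p)).
  case: p wE pE {up} => [wE|v [/= wE|]] //; first by rewrite wE eqxx in uw.
  by rewrite -wE /adj /= (negPf efE) !andbF.
apply/andP; split=> //=; rewrite rcons_path -wE symE /adj /= uw eE !andbT.
by apply: sub_path pE => a b; rewrite /adj /= => /andP[-> /subE].
Qed.

Lemma card_treesE (P : pred {set V}) :
  #|[set T in trees n | P (MD T)]| =
  #|[set p : {ffun V -> V} * V |
      parent_tree p.1 p.2 && P (MD (parent_edges p.1 p.2, p.2))]|.
Proof.
rewrite -[RHS](card_in_imset (f := fun p => (parent_edges p.1 p.2, p.2))).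
  congr #|pred_of_set _|; apply/setP => -[E r]; rewrite !inE /=.
  apply/andP/imsetP => [[/(tree_parent r)[f fr <-] PE]|[[f r'] + [-> ->]]].
    by exists (f, r) => //; rewrite inE /= fr.
  by rewrite inE /= => /andP[/parent_edges_tree].
move=> [f r] [g r']; rewrite !inE /= => /andP[fr _] /andP[gr _] [fg rr].
by subst r'; rewrite (parent_edges_inj fr gr fg).
Qed.

End ParentFunctions.

(** * Trees with a prescribed maximal decreasing subtree *)

Section FixedMD.
Local Open Scope nat_scope.
Variable n : nat.
Local Notation V := 'I_n.+1.
Implicit Types (f : {ffun V -> V}) (r u v w : V) (M : {set V}).

Lemma MD_parentP f r M : parent_tree f r ->
  (MD (parent_edges f r, r) == M) =
  (r \in M) && [forall v, (v != r) ==> ((v \in M) == (v < f v) && (f v \in M))].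
Proof.
move=> fr; apply/eqP/andP => [<-|[rM /forall_inP fM]].
  split; first exact: mem_MD_root.
  by apply/forall_inP => v vr; rewrite (mem_MD_parent fr vr).
apply/setP; apply: (parent_ind fr); first by rewrite mem_MD_root.
by move=> v vr IHv; rewrite mem_MD_parent // (eqP (fM v vr)) IHv.
Qed.

Definition above M v := [set u in M | v < u].

(** From the greatest element down, the factors are 1, 1, 2, ..., [#|M| - 1]; [maxn 1] gives the
    greatest element its single choice. The induction removes the least element, which changes no
    other factor. *)
Lemma prod_above M : \prod_(v in M) maxn 1 #|above M v| = (#|M|.-1)`!.
Proof.
have [m] := ubnP #|M|; elim: m M => // m IHm M; rewrite ltnS => leM.
have [->|[w0 w0M]] := set_0Vmem M; first by rewrite big_set0 cards0.
have [w wM wmin] := @arg_minnP _ w0 [in M] (@nat_of_ord n.+1) w0M.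
have ltw v : v \in M -> v != w -> w < v.
  by move=> vM vw; rewrite ltn_neqAle eq_sym vw wmin.
rewrite (big_setD1 w) //=.
have -> : above M w = M :\ w.
  apply/setP => v; rewrite !inE andbC; have [->|vw] := eqVneq v w; first by rewrite ltnn.
  by rewrite andb_idl // => vM; apply: ltw.
have cM : #|M| = #|M :\ w|.+1 by rewrite (cardsD1 w M) wM.
rewrite cM /=; transitivity (maxn 1 #|M :\ w| * #|M :\ w|.-1`!).
  rewrite -IHm -?cM //; congr (_ * _); apply: eq_bigr => v; rewrite !inE => /andP[vw vM].
  congr (maxn 1 #|pred_of_set _|); apply/setP => u; rewrite !inE.
  by have [->|//] := eqVneq u w; rewrite wM /= ltnNge ltnW // ltw.
by case: #|_| => // m'; rewrite (maxn_idPr _).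
Qed.

(** Independent choices of parents: the greatest vertex of [M] is the root, the others go up inside
    [M], and a vertex outside [M] avoids the larger vertices of [M], which would pull it into the
    decreasing subtree. *)
Definition MD_choices M v :=
  if v \in M then (if above M v == set0 then [set v] else above M v)
  else ~: M :|: below M v.

Lemma parent_tree_MD f r M : parent_tree f r -> MD (parent_edges f r, r) = M ->
  respects (MD_choices M) f && reaching M f.
Proof.
move=> fr /eqP; rewrite MD_parentP // => /andP[rM /forall_inP fM].
have /andP[/eqP froot /reachingP freach] := fr.
apply/andP; split; last first.
  apply/reachingP => v; have [k] := freach v; rewrite inE => /eqP kr.
  by exists k; rewrite kr.
(* Labels grow towards the root inside [M], so the root is its greatest element. *)
have ler v : v \in M -> v <= r.
  elim/(parent_ind fr): v => // v vr IHv; rewrite (eqP (fM v vr)) => /andP[vf /IHv].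
  exact: leq_trans (ltnW vf).
apply/respectsP => v; rewrite /MD_choices; have [->|vr] := eqVneq v r.
  rewrite rM froot; case: ifP; rewrite ?inE // => /negbT/set0Pn[u].
  by rewrite inE => /andP[/ler + ru]; rewrite leqNgt ru.
have := fM v vr; case: ifP => vM /eqP.
  move=> /esym/andP[vf fvM]; have fva : f v \in above M v by rewrite inE fvM.
  by case: ifP => // /eqP a0; rewrite a0 inE in fva.
rewrite !inE; case: (boolP (f v \in M)) => //= fvM; rewrite andbT => /esym/negbT.
rewrite -leqNgt leq_eqVlt => /orP[/eqP/val_inj fv|//].
by rewrite fv vM in fvM.
Qed.

(** Once inside [M], iterating [f] climbs strictly up to the greatest element of [M], which is
    therefore the root. *)
Lemma MD_choices_tree f M : M != set0 -> respects (MD_choices M) f -> reaching M f ->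
  exists2 r, parent_tree f r & MD (parent_edges f r, r) = M.
Proof.
move=> /set0Pn[r0 r0M] /respectsP fM /reachingP freach.
have [r rM rmax] := @arg_maxnP _ r0 [in M] (@nat_of_ord n.+1) r0M.
have ltr v : v \in M -> v != r -> v < r.
  by move=> vM vr; rewrite ltn_neqAle vr; apply: rmax.
have froot : f r = r.
  have := fM r; rewrite /MD_choices rM; case: ifP => [_|_]; rewrite !inE => /eqP //.
  by move=> /eqP /andP[/rmax + rf]; rewrite /= leqNgt rf.
have fabove v : v \in M -> v != r -> f v \in above M v.
  move=> vM vr; have := fM v; rewrite /MD_choices vM; case: ifP => // /eqP a0.
  by have : r \in above M v; [rewrite inE rM ltr | rewrite a0 in_set0].
have fr : parent_tree f r.
  rewrite /parent_tree froot eqxx; apply/reachingP => v.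
  have [k kM] := freach v; suff [i ir] : exists i, iter i f (iter k f v) \in [set r].
    by exists (i + k); rewrite iterD.
  move: (iter k f v) kM => {k}u; have [m] := ubnP (n.+1 - u); elim: m u => // m IHm u.
  have [->|ur] := eqVneq u r; first by exists 0; rewrite inE.
  rewrite ltnS => leu uM; have := fabove u uM ur; rewrite inE => /andP[fuM uf].
  have [|//|i ir] := IHm (f u).
    by apply: leq_trans leu; apply: ltn_sub2l.
  by exists i.+1; rewrite iterSr.
exists r => //; apply/eqP; rewrite MD_parentP // rM; apply/forall_inP => v vr.
case: (boolP (v \in M)) => vM.
  by have := fabove v vM vr; rewrite inE => /andP[-> ->].
have := fM v; rewrite /MD_choices (negPf vM) !inE; case: (f v \in M) => //=; last by rewrite andbF.
by move=> fv; rewrite andbT ltnNge ltnW.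
Qed.

(** The root is the only fixed point of the parent function, so functions alone are counted. Parents
    of vertices of [M] give the factorial by [prod_above]; the other vertices form a forest. *)
Lemma card_MD_eq M : M != set0 ->
  #|[set p : {ffun V -> V} * V |
      parent_tree p.1 p.2 && (MD (parent_edges p.1 p.2, p.2) == M)]| =
  (#|M|.-1)`! * #|forests (~: M) (below M)|.
Proof.
move=> M0; rewrite -(card_in_imset (f := fst)); last first.
  move=> [f r] [g r']; rewrite !inE /= => /andP[/andP[/eqP fr _] _] + fg; subst g.
  move=> /andP[/andP[_ /reachingP/(_ r)[k /set1P kr]] _].
  suff -> : r = r' by [].
  by rewrite -kr; elim: k {kr} => //= k <-; rewrite fr.
transitivity #|[set f | respects (MD_choices M) f && reaching M f]|.
  congr #|pred_of_set _|; apply/setP => f; rewrite inE; apply/imsetP/idP.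
    move=> [[g r]]; rewrite inE /= => /andP[fr /eqP fM] ->.
    exact: parent_tree_MD fr fM.
  move=> /andP[fM fr]; have [r ftr fMD] := MD_choices_tree M0 fM fr.
  by exists (f, r); rewrite // inE /= ftr fMD eqxx.
rewrite (card_family_split (S := ~: M)) => [|f h fh]; last exact: eq_reaching.
rewrite setCK -prod_above; congr (_ * _).
  apply: eq_bigr => v vM; rewrite /MD_choices vM; case: eqP => [->|/eqP].
    by rewrite cards1 cards0.
  by rewrite -card_gt0 => /maxn_idPr ->.
congr #|pred_of_set _|; apply/setP => f; rewrite !inE setCK; congr (_ && _).
by apply/respectsP/respectsP => fM v; have := fM v;
  rewrite /fixed_off /MD_choices inE; case: (v \in M).
Qed.
End FixedMD.

Lemma card_trees_MD n k : (k <= n)%N ->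
  (k.+1 * #|trees_MD n k|)%N%:R = coefs (tree0_series ^+ k.+1) n.+1 * n.+1`!%:R :> rat.
Proof.
move=> lekn; rewrite coefs_tree0_seriesX.
have -> : #|trees_MD n k| = (\sum_(M : {set 'I_n.+1} | #|M| == k.+1)
    k`! * #|forests (~: M) (below M)|)%N.
  rewrite (card_treesE (fun M => #|M| == k.+1)) -sum1dep_card.
  rewrite (partition_big (fun p : {ffun _} * _ => MD (parent_edges p.1 p.2, p.2))
    (fun M : {set _} => #|M| == k.+1)) /= => [|p /andP[]//].
  apply: eq_bigr => M /eqP cM; rewrite sum1dep_card.
  have M0 : M != set0 by rewrite -card_gt0 cM.
  rewrite -[in k`!](succnK k) -cM -card_MD_eq //.
  congr #|pred_of_set _|; apply/setP => p; rewrite !inE -andbA; congr (_ && _).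
  by rewrite andb_idl // => /eqP->; rewrite cM.
(* [card_forests] differentiates in [y], so the sum is formed over polynomials. Every [M] leaves
   [n - k] vertices, hence a common evaluation point. *)
pose H := subset_sum ('X : {poly rat}) [set: 'I_n.+1] k.+1.
transitivity ((H - H^`()).[(n - k)%:R] *+ k.+1`!).
  rewrite /H /subset_sum raddf_sum /= -sumrB horner_sum.
  rewrite -big_distrr /= mulnA -factS natrM mulr_natl; congr (_ *+ _).
  rewrite natr_sum big_mkcond [RHS]big_mkcond /=; apply: eq_bigr => M _.
  rewrite subsetT /=; case: eqP => // cM.
  have cCM : #|~: M| = (n - k)%N by rewrite cardsCs setCK card_ord cM subSS.
  rewrite card_forests => [|v vM]; last first.
    by rewrite disjoints_subset setCK; apply/subsetP => u; rewrite inE => /andP[].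
  rewrite /attach_poly setTD cCM.
  by under eq_bigr => v _ do rewrite polyC_natr.
have -> : (H - H^`()).[(n - k)%:R] *+ k.+1`! =
    (H *+ k.+1`! - (H *+ k.+1`!)^`()).[(n - k)%:R].
  by rewrite derivMn -mulrnBl hornerMn.
rewrite subset_sumE cardsT card_ord /diff_sum raddf_sum -sumrB horner_sum.
apply: eq_bigr => i _; rewrite /= derivMn -mulrnBl hornerMn; congr (_ *+ _).
rewrite -!polyC_natr -polyCB -(rmorph_sign polyC).
rewrite derivM derivC mul0r add0r deriv_exp derivD derivX derivC addr0 mul1r.
rewrite -mulrBr hornerM hornerC -mulrA; congr (_ * _).
rewrite hornerD hornerN hornerMn !horner_exp hornerD hornerX hornerC natrB //.
have -> : n%:R - k%:R + (k.+1%:R - i%:R) = n.+1%:R - i%:R :> rat.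
  by rewrite -!natr1; ring.
(* With [z = n + 1 - i], one has [z^(n+1) - (n+1) z^n = - i z^n]. *)
by rewrite exprS /= -(mulr_natl (_ ^+ _)) -mulrBl addrAC subrr add0r.
Qed.

(** * Power series *)

Section FpsConstants.
Variable R : comNzRingType.
Implicit Types (f : {fps R}) (a : R).

Lemma coefs_fpsCM a f i : coefs (fpsC a * f) i = a * coefs f i.
Proof.
rewrite coefsM big_ord_recl subn0 big1 ?addr0 // => j _.
by rewrite mul0r.
Qed.

Fact fpsC_is_zmod_morphism : zmod_morphism (@fpsC R).
Proof. by move=> a b; apply: fpsP => -[|i]; rewrite coefsB //= subr0. Qed.

Fact fpsC_is_monoid_morphism : monoid_morphism (@fpsC R).
Proof.
by split=> // a b; apply: fpsP => -[|i]; rewrite coefs_fpsCM //= mulr0.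
Qed.

HB.instance Definition _ :=
  GRing.isZmodMorphism.Build R {fps R} (@fpsC R) fpsC_is_zmod_morphism.
HB.instance Definition _ :=
  GRing.isMonoidMorphism.Build R {fps R} (@fpsC R) fpsC_is_monoid_morphism.

Lemma coefs_fpsXM f i : coefs (fpsX * f) i = if i is i'.+1 then coefs f i' else 0.
Proof.
rewrite coefsM big_ord_recl /= mul0r add0r; case: i => [|i]; first by rewrite big_ord0.
rewrite big_ord_recl /= mul1r subSS subn0 big1 ?addr0 // => j _.
by rewrite mul0r.
Qed.

Lemma coefs_fpsXn n i : coefs (fpsX ^+ n : {fps R}) i = (i == n)%:R.
Proof.
elim: n i => [|n IHn] i; first by rewrite coefs1.
by rewrite exprS coefs_fpsXM; case: i => // i; rewrite IHn.
Qed.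

End FpsConstants.

Lemma fps_geometric (R : comUnitRingType) (h : {fps R}) : coefs h 0 = 0 ->
  (1 - h)^-1 = fps_sum (fun m => h ^+ m).
Proof.
move=> h0; apply: mulr1_eq; rewrite mulrC; apply: fpsP => i.
transitivity (coefs ((\sum_(0 <= m < i.+1) h ^+ m) * (1 - h)) i).
  rewrite !coefsM; apply: eq_bigr => -[j /= ltji] _; congr (_ * _).
  rewrite coefs_fps_sum => [|m k]; last exact: coefsXn_eq0.
  rewrite coefs_sum [RHS](big_cat_nat (leq0n _) ltji) //= [X in _ + X]big_nat_cond.
  rewrite [X in _ + X]big1 ?addr0 // => m.
  by rewrite andbT => /andP[ltjm _]; rewrite coefsXn_eq0.
rewrite big_mkord mulrC -opprB mulNr -subrX1 opprB coefsB coefsXn_eq0 ?subr0 //.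
Qed.

(** * Reduction of the three identities to the coefficients of powers of [G] *)

Local Notation ratC a := (fpsC (fpsC a) : Qtx).

Lemma ratC_nat m : m%:R = ratC m%:R.
Proof. by rewrite !rmorph_nat. Qed.

Lemma ratC_natV m : (m.+1%:R)^-1 = ratC m.+1%:R^-1.
Proof.
rewrite ratC_nat; apply: mulr1_eq; rewrite -!rmorphM /= divff ?rmorph1 //.
by rewrite pnatr_eq0.
Qed.

Lemma ratC_factV m : (m`!%:R)^-1 = ratC m`!%:R^-1.
Proof. by rewrite -(prednK (fact_gt0 m)) ratC_natV. Qed.

(** A series over [rat] is read here in the outer variable [x], whereas [fpsC] would read it in
    [t]. *)
Definition lift_series (f : {fps rat}) : Qtx := Fps (fun i => fpsC (coefs f i)).

Lemma lift_seriesX f m : lift_series f ^+ m = lift_series (f ^+ m).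
Proof.
elim: m => [|m IHm]; first by apply: fpsP => -[|i] //=; rewrite rmorph0.
rewrite !exprS IHm; apply: fpsP => i; rewrite !coefsM /= rmorph_sum.
by apply: eq_bigr => j _; rewrite rmorphM.
Qed.

Lemma G_lift : G = lift_series tree0_series.
Proof.
apply: fpsP => i; rewrite /G.
have coefG m j : coefs ((m ^ m)%:R * (x ^+ m.+1 / m.+1`!%:R) : Qtx) j =
    (if j == m.+1 then fpsC (coefs tree0_series j) else 0).
  rewrite ratC_factV ratC_nat [x ^+ _ * _]mulrC mulrA -!rmorphM coefs_fpsCM coefs_fpsXn /=.
  by case: eqP => [->|_]; rewrite ?mulr1 ?mulr0.
rewrite coefs_fps_sum => [|m j ltjm]; last first.
  by rewrite coefG; case: eqP => // jm; rewrite jm ltnNge leqnSn in ltjm.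
under eq_bigr => m _ do rewrite coefG.
case: i => [|i]; first by rewrite big_nat1 /= rmorph0.
rewrite big_nat_recr //= big_nat_recr //= eqxx eqn_leq ltnn andbF addr0.
by rewrite big_nat_cond big1 ?add0r // => m /andP[/andP[_ mi] _]; rewrite eqSS gtn_eqF.
Qed.

Lemma coefs_tG0 : coefs (t * G) 0 = 0.
Proof. by rewrite coefs_fpsCM G_lift /= rmorph0 mulr0. Qed.

Lemma coefs_tGX m i :
  coefs ((t * G) ^+ m) i = fpsX ^+ m * fpsC (coefs (tree0_series ^+ m) i).
Proof. by rewrite exprMn G_lift lift_seriesX -rmorphXn coefs_fpsCM. Qed.

(** Common to the three identities, with [a m] equal to [1/m!], 1 and [1/m]. At [x^i] only
    [n = i - 1] contributes on the left, and its summand for [k] is the term of [(t G)^(k+1)] on the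
    right. *)
Lemma coefs_weighted_sum (w : nat -> nat -> rat) (a : nat -> rat) i :
    (forall n k, (k <= n)%N -> w n k = a k.+1 * coefs (tree0_series ^+ k.+1) n.+1) ->
  coefs (fps_sum (fun n : nat =>
    \sum_(0 <= k < n.+1) ratC (w n k) * t ^+ k.+1 * x ^+ n.+1)) i =
  \sum_(0 <= m < i) coefs (ratC (a m.+1) * (t * G) ^+ m.+1) i.
Proof.
move=> wE.
have coefu n j : coefs (\sum_(0 <= k < n.+1) ratC (w n k) * t ^+ k.+1 * x ^+ n.+1) j =
    if j == n.+1 then \sum_(0 <= k < n.+1) fpsC (w n k) * fpsX ^+ k.+1 else 0.
  rewrite -mulr_suml.
  transitivity (coefs (fpsC (\sum_(0 <= k < n.+1) fpsC (w n k) * fpsX ^+ k.+1) * x ^+ n.+1) j).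
    congr (coefs (_ * _) _); rewrite rmorph_sum; apply: eq_bigr => k _.
    by rewrite rmorphM rmorphXn.
  by rewrite coefs_fpsCM coefs_fpsXn; case: eqP => _; rewrite ?mulr1 ?mulr0.
rewrite coefs_fps_sum => [|m j ltjm]; last first.
  by rewrite coefu; case: eqP => // jm; rewrite jm ltnNge leqnSn in ltjm.
under eq_bigr => n _ do rewrite coefu.
case: i => [|i]; first by rewrite big_nat1 big_geq.
transitivity (\sum_(0 <= k < i.+1) fpsC (w i k) * fpsX ^+ k.+1).
  rewrite big_nat_recr //= big_nat_recr //= eqxx eqn_leq ltnn andbF addr0.
  by rewrite big_nat_cond big1 ?add0r // => n /andP[/andP[_ ni] _]; rewrite eqSS gtn_eqF.
apply: eq_big_nat => k /andP[_ ki].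
by rewrite coefs_fpsCM coefs_tGX wE // rmorphM -mulrA [fpsX ^+ _ * _]mulrC.
Qed.

Lemma coefs_tG_sum (a : nat -> rat) i :
  coefs (fps_sum (fun m : nat => ratC (a m) * (t * G) ^+ m)) i =
  coefs (ratC (a 0%N)) i + \sum_(0 <= m < i) coefs (ratC (a m.+1) * (t * G) ^+ m.+1) i.
Proof.
rewrite coefs_fps_sum => [|m j ltjm]; last first.
  by rewrite coefs_fpsCM coefsXn_eq0 ?mulr0 // coefs_tG0.
by rewrite big_nat_recl // expr0 mulr1.
Qed.

Theorem theorem3p2 :
  [/\ 1 + fps_sum (fun n : nat => \sum_(0 <= k < n.+1)
            #|trees_MD n k|%:R * (t ^+ k.+1 / k`!%:R) * (x ^+ n.+1 / (n.+1)`!%:R))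
        = fps_exp (t * G),
      1 + fps_sum (fun n : nat => \sum_(0 <= k < n.+1)
            #|trees_MD n k|%:R * k.+1%:R * t ^+ k.+1 * (x ^+ n.+1 / (n.+1)`!%:R))
        = (1 - t * G)^-1
    & fps_sum (fun n : nat => \sum_(0 <= k < n.+1)
            #|trees_MD n k|%:R * t ^+ k.+1 * (x ^+ n.+1 / (n.+1)`!%:R))
        = - fps_ln (1 - t * G)].
Proof.
have fact_neq0 m : m`!%:R != 0 :> rat by rewrite pnatr_eq0 -lt0n fact_gt0.
have treesE n k : (k <= n)%N ->
    coefs (tree0_series ^+ k.+1) n.+1 = #|trees_MD n k|%:R * k.+1%:R / n.+1`!%:R.
  by move=> lekn; rewrite -natrM mulnC card_trees_MD // mulfK.
split.
- transitivity (fps_sum (fun m : nat => ratC m`!%:R^-1 * (t * G) ^+ m)); last first.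
    by congr fps_sum; apply/funext => m; rewrite mulrC ratC_factV.
  apply: fpsP => i; rewrite coefsD coefs_tG_sum invr1; congr (_ + _).
  pose w n k : rat := #|trees_MD n k|%:R / k`!%:R / n.+1`!%:R.
  rewrite -(coefs_weighted_sum (w := w) (a := fun m => m`!%:R^-1)) => [|n k lekn].
    congr (coefs (fps_sum _) _); apply/funext => n; apply: eq_bigr => k _.
    rewrite !ratC_factV !ratC_nat /w !rmorphM /=.
    by move: (ratC _) (ratC _) (ratC _) => A B C; ring.
  have field_eq (a b c d : rat) : b != 0 -> c != 0 -> d != 0 ->
      a / c / d = (b * c)^-1 * (a * b / d).
    by move=> b0 c0 d0; field; rewrite b0 c0 d0.
  by rewrite treesE // (factS k) natrM; apply: field_eq => //; rewrite pnatr_eq0.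
- rewrite fps_geometric ?coefs_tG0 //.
  transitivity (fps_sum (fun m : nat => ratC 1 * (t * G) ^+ m)); last first.
    by congr fps_sum; apply/funext => m; rewrite !rmorph1 mul1r.
  apply: fpsP => i; rewrite coefsD (coefs_tG_sum (fun=> 1)); congr (_ + _).
  pose w n k : rat := #|trees_MD n k|%:R * k.+1%:R / n.+1`!%:R.
  rewrite -(coefs_weighted_sum (w := w) (a := fun=> 1)) => [|n k lekn].
    congr (coefs (fps_sum _) _); apply/funext => n; apply: eq_bigr => k _.
    rewrite !ratC_factV !ratC_nat /w !rmorphM /=.
    by move: (ratC _) (ratC _) (ratC _) => A B C; ring.
  by rewrite treesE // mul1r.
(* The logarithm is expanded at [f - 1 = - t G], and [(-1)^m (- t G)^(m+1) = - (t G)^(m+1)]. *)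
have lnE : fps_ln (1 - t * G) =
    fps_sum (fun m : nat => - (ratC m.+1%:R^-1 * (t * G) ^+ m.+1)).
  congr fps_sum; apply/funext => m; rewrite ratC_natV addrAC subrr add0r (exprNn (t * G)).
  by rewrite mulrA exprS mulN1r mulrN -expr2 sqrr_sign mulN1r mulNr mulrC.
apply: fpsP => i; rewrite coefsN lnE [in RHS]coefs_fps_sum => [|m j ltjm]; last first.
  by rewrite coefsN coefs_fpsCM coefsXn_eq0 ?mulr0 ?oppr0 ?coefs_tG0 // ltnW.
(* The exponent exceeds the index by one: the last term, [m = i], holds [(t G)^(i+1)], which has no
   [x^i]. *)
rewrite [in RHS]big_nat_recr // coefsN coefs_fpsCM coefsXn_eq0 ?coefs_tG0 // mulr0 oppr0.
rewrite Monoid.mulm1 -sumrN.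
pose w n k : rat := #|trees_MD n k|%:R / n.+1`!%:R.
transitivity (\sum_(0 <= m < i) coefs (ratC m.+1%:R^-1 * (t * G) ^+ m.+1) i); last first.
  by apply: eq_bigr => m _; rewrite coefsN opprK.
rewrite -(coefs_weighted_sum (w := w) (a := fun m => m%:R^-1)) => [|n k lekn].
  congr (coefs (fps_sum _) _); apply/funext => n; apply: eq_bigr => k _.
  rewrite !ratC_factV !ratC_nat /w !rmorphM /=.
  by move: (ratC _) (ratC _) => A B; ring.
by rewrite treesE // /w mulrA mulrCA mulVf ?mulr1 // pnatr_eq0.
Qed.
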